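(* Let $n\ge1$. Then $$LG^R(n,2n)=\Big\{X\in Gr(n,2n): \Delta_I(X)=\Delta_{\mathcal R(I)}(X)\ \text{ for all } I\in\tbinom{[2n]}{n}\Big\}.$$ Similarly, $$LG^R_{\ge0}(n,2n)=\Big\{X\in Gr(n,2n): \Delta_I(X)=\Delta_{\mathcal R(I)}(X)\ge 0\ \text{ for all } I\in\tbinom{[2n]}{n}\Big\}.$$
   Context: $Gr(n,2n)$ is the real Grassmannian of $n$-dimensional subspaces of $\mathbb R^{2n}$; $\Delta_I(X)$, for $I\in\binom{[2n]}{n}=\{I\subset\{1,\dots,2n\}:|I|=n\}$, are the Plücker coordinates (maximal minors of a representing $n\times 2n$ matrix), defined up to common rescaling (inequalities $\Delta_I\ge0$ are understood for a suitable choice of scaling). $Gr_{\ge0}(n,2n)$ is the set of $X$ with all Plücker coordinates nonnegative. $R(x,y)=\sum_{i=1}^n(-1)^{i-1}(x_iy_{n+i}-x_{n+i}y_i)$; $LG^R(n,2n)=\{X\in Gr(n,2n):R(x,y)=0\ \forall x,y\in X\}$; $LG^R_{\ge0}(n,2n)=LG^R(n,2n)\cap Gr_{\ge0}(n,2n)$. For $I\in\binom{[2n]}{n}$, $\mathcal R(I)=\rho([2n]\setminus I)$, where $\rho(i)=i+n \bmod 2n$ on $[2n]$. *)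

(* Defs.v *)
From HB Require Import structures.
From mathcomp Require Import all_boot all_order all_algebra.
From mathcomp Require Import boolp classical_sets reals.
Set Implicit Arguments.
Unset Strict Implicit.
Unset Printing Implicit Defensive.
Import Order.TTheory GRing.Theory Num.Theory.
Local Open Scope classical_set_scope.
Local Open Scope ring_scope.

(* Indices are 0-based: the element i of {1, ..., 2n} is i - 1 : 'I_(n + n). *)

Lemma rho_subproof (n : nat) (i : 'I_(n + n)) : ((i + n) %% (n + n) < n + n)%N.
Proof. by rewrite ltn_mod (leq_ltn_trans (leq0n i) (ltn_ord i)). Qed.

Definition rho (n : nat) (i : 'I_(n + n)) : 'I_(n + n) :=
  Ordinal (rho_subproof i).

Definition calR (n : nat) (I : {set 'I_(n + n)}) : {set 'I_(n + n)} :=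
  (@rho n @: ~: I)%SET.

Definition Gr (R : realType) (n : nat) : set {vspace 'rV[R]_(n + n)} :=
  [set X | \dim X = n].
Arguments Gr : clear implicits.

Definition represents (R : realType) (n : nat)
    (A : 'M[R]_(n, n + n)) (X : {vspace 'rV[R]_(n + n)}) : Prop :=
  basis_of X [seq row i A | i <- enum 'I_n].

(* [enum I] lists I in increasing order; the default value of [nth] is never *)
(* reached when #|I| = n, the only case in which [max_minor] is used.        *)
Definition max_minor (R : realType) (n : nat)
    (A : 'M[R]_(n, n + n)) (I : {set 'I_(n + n)}) : R :=
  \det (\matrix_(i < n, j < n) A i (nth (lshift n j) (enum I) j)).

(* p is one of the choices, up to common rescaling, of the family of Pluecker *)
(* coordinates of X; only its values at the n-element sets are constrained.   *)
Definition is_plucker (R : realType) (n : nat)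
    (X : {vspace 'rV[R]_(n + n)}) (p : {set 'I_(n + n)} -> R) : Prop :=
  exists A : 'M[R]_(n, n + n), represents A X /\
  exists c : R, c != 0 /\
    forall I : {set 'I_(n + n)}, #|I| = n -> p I = c * max_minor A I.

(* Hence a homogeneous condition on the coordinates holds for one choice of  *)
(* scaling if and only if it holds for all of them.                          *)
Lemma is_plucker_proportional (R : realType) (n : nat)
    (X : {vspace 'rV[R]_(n + n)}) (p q : {set 'I_(n + n)} -> R) :
  is_plucker X p -> is_plucker X q ->
  exists c : R, c != 0 /\
    forall I : {set 'I_(n + n)}, #|I| = n -> q I = c * p I.
Proof.
suff key (A B : 'M[R]_(n, n + n)) : represents A X -> represents B X ->
    exists d, forall I, max_minor B I = d * max_minor A I.
  case=> A [hA [a [a0 pA]]] [B [hB [b [b0 qB]]]].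
  have [d dP] := key _ _ hA hB; have [e eP] := key _ _ hB hA.
  have [d0|d0] := eqVneq d 0.
    exists 1; split=> [|I hI]; first exact: oner_neq0.
    by rewrite pA // qB // eP dP d0 !(mul0r, mulr0).
  exists (b * d / a); split=> [|I hI].
    by rewrite !mulf_neq0 ?invr_neq0.
  by rewrite pA // qB // dP !mulrA divfK.
move=> hA hB.
have sz (C : 'M[R]_(n, n + n)) : size [seq row i C | i <- enum 'I_n] == n.
  by rewrite size_map size_enum_ord.
pose tA := Tuple (sz A).
have nthA (C : 'M[R]_(n, n + n)) (i : 'I_n) :
    [seq row i C | i <- enum 'I_n]`_i = row i C.
  by rewrite (nth_map i) ?size_enum_ord ?ltn_ord // nth_ord_enum.
pose M : 'M[R]_n := \matrix_(i, k) coord tA k (row i B).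
have rowB i : row i B = \sum_k M i k *: row k A.
  have : row i B \in <<tA>>%VS.
    rewrite (span_basis hA); apply: (basis_mem hB).
    by apply: map_f; rewrite mem_enum.
  move/coord_span => {1}->; apply: eq_bigr => k _.
  by rewrite mxE /= nthA.
exists (\det M) => I; rewrite /max_minor -det_mulmx; congr (\det _).
apply/matrixP => i j; rewrite !mxE.
have /rowP/(_ (nth (lshift n j) (enum I) j)) := rowB i.
rewrite mxE summxE => ->; apply: eq_bigr => k _.
by rewrite !mxE.
Qed.

Definition Gr_ge0 (R : realType) (n : nat) : set {vspace 'rV[R]_(n + n)} :=
  [set X | Gr R n X /\
    exists p, is_plucker X p /\
      forall I : {set 'I_(n + n)}, #|I| = n -> 0 <= p I].
Arguments Gr_ge0 : clear implicits.

Definition formR (R : realType) (n : nat) (x y : 'rV[R]_(n + n)) : R :=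
  \sum_(i < n) (-1) ^+ i *
    (x 0 (lshift n i) * y 0 (rshift n i) - x 0 (rshift n i) * y 0 (lshift n i)).

Definition LGR (R : realType) (n : nat) : set {vspace 'rV[R]_(n + n)} :=
  [set X | Gr R n X /\ forall x y, x \in X -> y \in X -> formR x y = 0].
Arguments LGR : clear implicits.

Definition LGR_ge0 (R : realType) (n : nat) : set {vspace 'rV[R]_(n + n)} :=
  LGR R n `&` Gr_ge0 R n.
Arguments LGR_ge0 : clear implicits.

(* Main.v *)
(* Let A represent X, and let N := twist A be A times the matrix of the form R up to sign, so that
   X is isotropic iff A N^T = 0.  The maximal minors of N are, up to sign, those of A on the columns
   shifted by rho.  Multiplying the stacked matrix (A; N), with columns permuted by s, by a suitable
   block triangular matrix shows that A N^T = 0 makes the minor of A on a set of columns equal to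
   +-c times the complementary minor of N, where c = det (N N^T) / det (A; N).  Writing A = (B, C)
   and D = diag (1, -1, 1, ...), the determinant of (A; N) is
   det D det (B + i C D) det (B - i C D) = det D det (A A^T) = det D det (N N^T),
   so c = det D, and the signs cancel to give Delta_I = Delta_R(I).  Conversely, proportionality of
   complementary minors already gives A N^T = 0 when applied to one nonzero minor A1 and to the
   minors obtained by exchanging one column: by Cramer's rule these are the entries of A1^-1 A2 and
   of N2^-1 N1, so A1^-1 A2 = - (N2^-1 N1)^T. *)
Require Import Defs.
From HB Require Import structures.
From mathcomp Require Import all_boot all_order all_algebra.
From mathcomp Require Import boolp classical_sets reals.
From mathcomp Require Import fingroup perm complex ring.
Set Implicit Arguments.
Unset Strict Implicit.
Unset Printing Implicit Defensive.
Import Order.TTheory GRing.Theory Num.Theory.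
Local Open Scope classical_set_scope.
Local Open Scope ring_scope.

(** * Complementary blocks of columns and block determinants *)

(** A permutation [s] encodes an ordered set of columns together with an ordering of its complement,
    so that all signs can be compared with the parity of [s]. *)
Definition left_cols (T : Type) (m n p : nat) (s : 'S_(m + n)) (A : 'M[T]_(p, m + n)) :
  'M[T]_(p, m) := colsub (s \o lshift n) A.
Definition right_cols (T : Type) (m n p : nat) (s : 'S_(m + n)) (A : 'M[T]_(p, m + n)) :
  'M[T]_(p, n) := colsub (s \o @rshift m n) A.

Lemma col_perm_row_mx (T : Type) (m n p : nat) (s : 'S_(m + n)) (A : 'M[T]_(p, m + n)) :
  col_perm s A = row_mx (left_cols s A) (right_cols s A).
Proof. by rewrite col_permEsub -[LHS]hsubmxK lsubmxEsub rsubmxEsub -!colsub_comp. Qed.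

Lemma mulmx_tr_cols (R : comPzRingType) (m n p q : nat) (s : 'S_(m + n))
    (A : 'M[R]_(p, m + n)) (N : 'M[R]_(q, m + n)) :
  left_cols s A *m (left_cols s N)^T + right_cols s A *m (right_cols s N)^T = A *m N^T.
Proof.
rewrite -mul_row_col -tr_row_mx -!col_perm_row_mx !col_permE trmx_mul mulmxA.
by rewrite -(mulmxA A) tr_perm_mx invgK -perm_mxM mulVg perm_mx1 mulmx1.
Qed.

Lemma complementary_minors (R : comPzRingType) (n : nat) (s : 'S_(n + n))
    (A N : 'M[R]_(n, n + n)) : A *m N^T = 0 ->
  (-1) ^+ s * \det (right_cols s N) * \det (col_mx A N) =
  \det (left_cols s A) * \det (N *m N^T).
Proof.
move=> AN0; rewrite -(det_lblock _ (left_cols s N)).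
(* By [mulmx_tr_cols] the right block column of the product consists of [A *m N^T], which vanishes,
   and [N *m N^T]. *)
have <- : col_perm s (col_mx A N) *m
   block_mx 1%:M (left_cols s N)^T 0 (right_cols s N)^T =
   block_mx (left_cols s A) 0 (left_cols s N) (N *m N^T).
  have -> : col_perm s (col_mx A N) =
      block_mx (left_cols s A) (right_cols s A) (left_cols s N) (right_cols s N).
    rewrite /block_mx -!col_perm_row_mx.
    by rewrite !col_permEsub; apply/matrixP=> i j; rewrite !mxE; case: splitP => k; rewrite !mxE.
  by rewrite mulmx_block !mulmx1 !mulmx0 !addr0 !mulmx_tr_cols AN0.
by rewrite det_mulmx det_ublock det1 mul1r det_tr col_permE det_mulmx det_perm odd_permV
  -[RHS]mulrA [RHS]mulrC.
Qed.

(** The symmetry hypothesis cancels the cross terms of [(B + i *: X) *m (B - i *: X)^T]. Conjugation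
    by a unipotent block matrix makes the left-hand matrix block triangular with diagonal blocks
    [B + i *: X] and [B - i *: X]. *)
Lemma det_rotation_block (R : comPzRingType) (n : nat) (i : R) (B X : 'M[R]_n) :
  i ^+ 2 = -1 -> B *m X^T = X *m B^T ->
  \det (block_mx B X (- X) B) = \det (B *m B^T + X *m X^T).
Proof.
move=> i2 BX.
have -> : B *m B^T + X *m X^T = (B + i *: X) *m (B - i *: X)^T.
  rewrite linearB /= linearZ /= mulmxDl !mulmxBr -!scalemxAl -!scalemxAr BX.
  rewrite scalerA -expr2 i2 scaleN1r opprK addrA; congr (_ + _).
  by rewrite subrK.
rewrite det_mulmx det_tr -(det_lblock _ (- X)).
have E : block_mx 1%:M (- i *: 1%:M) 0 1%:M *m block_mx B X (- X) B *m
   block_mx 1%:M (i *: 1%:M) 0 1%:M = block_mx (B + i *: X) 0 (- X) (B - i *: X).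
  rewrite !mulmx_block !(mul0mx, mulmx0, mul1mx, mulmx1, add0r, addr0).
  rewrite !(scaleNr, mulNmx, mulmxN, opprK) -!scalemxAl -!scalemxAr !(mul1mx, mulmx1).
  rewrite scalerDr scalerA -expr2 i2 scaleN1r; congr block_mx.
  - by rewrite addrA subrK subrr.
  - by rewrite addrC.
by rewrite -E !det_mulmx !det_ublock !det1 !mul1r mulr1.
Qed.

(** The square root of -1 is adjoined in [R[i]], and the identity descends along the injective
    morphism [real_complex R]. *)
Lemma det_rotation_block_rcf (R : rcfType) (n : nat) (B X : 'M[R]_n) :
  B *m X^T = X *m B^T ->
  \det (block_mx B X (- X) B) = \det (B *m B^T + X *m X^T).
Proof.
move=> BX; apply: (@fmorph_inj _ _ (real_complex R)).
rewrite -!det_map_mx map_block_mx map_mxN map_mxD !map_mxM -!map_trmx.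
apply: (det_rotation_block (sqr_i R)).
by rewrite !map_trmx -!map_mxM BX.
Qed.

(** * Cramer's rule, exchange of columns, and the converse direction *)

(** Cramer's rule in adjugate form: the cofactors along column [j] do not see that column. *)
Lemma det_col_replaced (R : comPzRingType) (n : nat) (A : 'M[R]_n) (v : 'cV[R]_n) (j : 'I_n) :
  \det (\matrix_(i, k) if k == j then v i 0 else A i k) = (\adj A *m v) j 0.
Proof.
rewrite (expand_det_col _ j) mxE; apply: eq_bigr => i _.
rewrite !mxE eqxx mulrC; congr (_ * _ * _); congr (\det _).
by apply/matrixP=> a b; rewrite !mxE eq_sym (negbTE (neq_lift _ _)).
Qed.

Lemma extend_injective (m n : nat) (f : 'I_m -> 'I_(m + n)) :
  injective f -> exists s : 'S_(m + n), forall i, s (lshift n i) = f i.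
Proof.
move=> f_inj; pose C := ~: (f @: 'I_m).
have cardC : #|C| = n.
  by have := cardsC (f @: 'I_m); rewrite card_imset // !card_ord => /addnI.
pose g j : 'I_(m + n) := enum_val (cast_ord (esym cardC) j).
pose h x := match split x with inl i => f i | inr j => g j end.
have gC j : g j \notin f @: 'I_m by have := enum_valP (cast_ord (esym cardC) j); rewrite inE.
have h_inj : injective h.
  move=> x y; rewrite /h.
  case: (splitP x) => i xi; case: (splitP y) => j yj.
  - by move/f_inj => ij; apply: val_inj; rewrite /= xi yj ij.
  - by move=> fg; case/negP: (gC j); rewrite -fg imset_f.
  - by move=> fg; case/negP: (gC i); rewrite fg imset_f.
  - by move/enum_val_inj/cast_ord_inj => ij; apply: val_inj; rewrite /= xi yj ij.
exists (perm h_inj) => i; rewrite permE /h.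
by rewrite (unsplitK (inl i : 'I_m + 'I_n)).
Qed.

(** [fullrankfun] selects independent columns of [A], and [extend_injective] moves them to the
    front. *)
Lemma exists_nonzero_minor (F : fieldType) (m n : nat) (A : 'M[F]_(m, m + n)) :
  row_free A -> exists s : 'S_(m + n), \det (left_cols s A) != 0.
Proof.
move=> Afree; have Afull : row_full A^T by rewrite /row_full mxrank_tr.
have [s sE] := extend_injective (@fullrankfun_inj _ _ _ _ Afull).
exists s; rewrite -unitfE -[_ \is a _]/(_ \in unitmx) -unitmx_tr -row_full_unit.
congr (row_full _ = true) : (fullrowsub_full Afull).
by apply/matrixP=> i j; rewrite !mxE /= sE.
Qed.

Lemma left_cols_swap (T : Type) (m n p : nat) (s : 'S_(m + n)) (A : 'M[T]_(p, m + n)) j l :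
  left_cols (tperm (lshift n j) (rshift m l) * s)%g A =
  \matrix_(i, k) if k == j then right_cols s A i l else left_cols s A i k.
Proof.
apply/matrixP=> i k; rewrite !mxE /= permM.
have [->|kj] := eqVneq k j; first by rewrite tpermL ?mxE.
by rewrite tpermD ?mxE ?eq_rlshift // (inj_eq (@lshift_inj _ _)) eq_sym.
Qed.

Lemma right_cols_swap (T : Type) (m n p : nat) (s : 'S_(m + n)) (A : 'M[T]_(p, m + n)) j l :
  right_cols (tperm (lshift n j) (rshift m l) * s)%g A =
  \matrix_(i, k) if k == l then left_cols s A i j else right_cols s A i k.
Proof.
apply/matrixP=> i k; rewrite !mxE /= permM.
have [->|kl] := eqVneq k l; first by rewrite tpermR ?mxE.
by rewrite tpermD ?mxE ?eq_lrshift // (inj_eq (@rshift_inj _ _)) eq_sym.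
Qed.

Lemma orthogonal_of_complementary_minors (F : fieldType) (n : nat)
    (A N : 'M[F]_(n, n + n)) (c : F) : row_free A ->
  (forall s : 'S_(n + n),
     \det (left_cols s A) = c * (-1) ^+ s * \det (right_cols s N)) ->
  A *m N^T = 0.
Proof.
move=> Afree minorE; have [s dA0] := exists_nonzero_minor Afree.
rewrite -(mulmx_tr_cols s).
move: (minorE s) dA0; set A1 := left_cols s A; set A2 := right_cols s A.
set N1 := left_cols s N; set N2 := right_cols s N; set k := c * _ => dA dA0.
(* Compare the minors of A and N after exchanging the columns s (lshift j) and s (rshift l). *)
have swapE : \adj A1 *m A2 = - k *: (\adj N2 *m N1)^T.
  apply/matrixP=> j l; rewrite !mxE.
  have := minorE (tperm (lshift n j) (rshift n l) * s)%g.
  rewrite odd_permM odd_tperm eq_lrshift /= signrN mulrN -/k.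
  rewrite left_cols_swap right_cols_swap -/A1 -/A2 -/N1 -/N2.
  have -> : (\matrix_(i, k0) (if k0 == j then A2 i l else A1 i k0)) =
     \matrix_(i, k0) (if k0 == j then (col l A2) i 0 else A1 i k0).
    by apply/matrixP=> a b; rewrite !mxE.
  have -> : (\matrix_(i, k0) (if k0 == l then N1 i j else N2 i k0)) =
     \matrix_(i, k0) (if k0 == l then (col j N1) i 0 else N2 i k0).
    by apply/matrixP=> a b; rewrite !mxE.
  rewrite !det_col_replaced !mxE => E.
  have -> : \sum_j0 (\adj A1) j j0 * A2 j0 l = \sum_j0 (\adj A1) j j0 * (col l A2) j0 0.
    by apply: eq_bigr => a _; rewrite !mxE.
  by rewrite E; congr (_ * _); apply: eq_bigr => a _; rewrite !mxE.
(* Scaling by [\det A1] turns inverses into adjugates: by [swapE] the second summand becomes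
   [- (k * \det N2) *: (A1 *m N1^T)], which cancels the first because [\det A1 = k * \det N2]. *)
apply/eqP; rewrite -(inj_eq (scalerI dA0)) scaler0; apply/eqP.
rewrite scalerDr.
have -> : \det A1 *: (A2 *m N2^T) = A1 *m (\adj A1 *m A2) *m N2^T.
  by rewrite mulmxA mul_mx_adj -mul_scalar_mx mulmxA.
rewrite swapE -!scalemxAr -scalemxAl -mulmxA -trmx_mul mulmxA mul_mx_adj.
by rewrite mul_scalar_mx linearZ /= -scalemxAr scalerA mulNr -dA scaleNr subrr.
Qed.

(** * Signs counting inversions *)

(** For injective [f] this is the sign of the permutation sorting the values of [f]. Allowing
    arbitrary natural values lets it apply to each half of a permutation separately. *)
Definition inv_sign (R : pzRingType) (m : nat) (f : 'I_m -> nat) : R :=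
  \prod_(i < m) \prod_(j < m | (i < j)%N) (-1) ^+ (f j < f i)%N.

Lemma inv_sign_sqr (R : comPzRingType) (m : nat) (f : 'I_m -> nat) :
  inv_sign R f * inv_sign R f = 1.
Proof.
rewrite -big_split big1 //= => i _; rewrite -big_split big1 //= => j _.
by rewrite -signr_addb addbb.
Qed.

Lemma inv_sign_increasing (R : pzRingType) (m : nat) (f : 'I_m -> nat) :
  (forall i j : 'I_m, (i < j)%N -> (f i < f j)%N) -> inv_sign R f = 1.
Proof.
move=> f_incr; rewrite /inv_sign big1 // => i _; rewrite big1 // => j ij.
by rewrite ltnNge ltnW ?f_incr.
Qed.

(* Both signs can be read off a Vandermonde determinant with nodes f i. *)
Lemma inv_sign_perm (R : realDomainType) (m : nat) (f : 'I_m -> nat) (t : 'S_m) :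
  injective f -> inv_sign R (f \o t) = (-1) ^+ t * inv_sign R f.
Proof.
have sgV (g : 'I_m -> nat) : injective g ->
    inv_sign R g = Num.sg (\det (Vandermonde m (\row_i (g i)%:R : 'rV[R]_m))).
  move=> g_inj; rewrite det_Vandermonde (big_morph _ (@sgrM R) (@sgr1 R)).
  apply: eq_bigr => i _; rewrite (big_morph _ (@sgrM R) (@sgr1 R)).
  apply: eq_bigr => j ij; rewrite !mxE.
  have : g j != g i by rewrite (inj_eq g_inj) neq_ltn ij orbT.
  rewrite neq_ltn; case: ltngtP => // gij _; first by rewrite ltr0_sg // subr_lt0 ltr_nat.
  by rewrite gtr0_sg // subr_gt0 ltr_nat.
move=> f_inj; rewrite !sgV //; last by apply: inj_comp f_inj _; exact: perm_inj.
have -> : Vandermonde m (\row_i (f (t i))%:R : 'rV[R]_m) =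
    col_perm t (Vandermonde m (\row_i (f i)%:R)).
  by apply/matrixP=> i j; rewrite !mxE.
rewrite col_permE det_mulmx det_perm odd_permV sgrM mulrC.
by congr (_ * _); case: (odd_perm t); rewrite ?sgrN sgr1.
Qed.

Lemma perm_sign_inv_sign (R : realDomainType) (m : nat) (s : 'S_m) :
  (-1) ^+ s = inv_sign R (fun i => s i).
Proof.
rewrite -[RHS]/(inv_sign R (@nat_of_ord m \o s)) inv_sign_perm; last exact: val_inj.
by rewrite inv_sign_increasing ?mulr1.
Qed.

Lemma prod_square_split (R : comPzRingType) (m : nat) (F : 'I_m -> 'I_m -> R) :
  \prod_i \prod_j F i j =
  (\prod_i F i i) * \prod_(i < m) \prod_(j < m | (i < j)%N) (F i j * F j i).
Proof.
have -> : \prod_(i < m) \prod_(j < m | (i < j)%N) (F i j * F j i) =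
    (\prod_(i < m) \prod_(j < m | (i < j)%N) F i j) *
    (\prod_(i < m) \prod_(j < m | (j < i)%N) F i j).
  under eq_bigr do rewrite big_split; rewrite big_split /=; congr (_ * _).
  by rewrite (exchange_big_dep xpredT).
rewrite -!big_split; apply: eq_bigr => i _.
rewrite (bigD1 i) //=; congr (_ * _).
rewrite (bigID (fun j : 'I_m => (i < j)%N)) /=; congr (_ * _); apply: eq_bigl => j.
  by rewrite neq_ltn; case: ltngtP.
by rewrite -leqNgt neq_ltn; case: ltngtP.
Qed.

Lemma prod_sign_lt (R : pzRingType) (m : nat) (b : 'I_m) :
  \prod_(x < m) (-1) ^+ (b < x)%N = (-1) ^+ (m - b.+1) :> R.
Proof.
rewrite -(big_mkord xpredT (fun x => (-1) ^+ (b < x)%N)).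
rewrite (big_cat_nat (n := b.+1)) //=.
rewrite big_nat big1 ?mul1r; last by move=> i /=; rewrite ltnS => /= ib; rewrite ltnNge ib.
rewrite big_nat (eq_bigr (fun=> -1)) -?big_nat; last by move=> i /andP[->].
by rewrite prodr_const_nat.
Qed.

(** Each unordered pair of distinct indices contributes exactly one factor -1 whatever the
    injection, so the product may be computed for the identity. *)
Lemma prod_sign_lt_inj (R : comPzRingType) (m : nat) (f : 'I_m -> nat) : injective f ->
  \prod_i \prod_j (-1) ^+ (f i < f j)%N = \prod_(i < m) (-1) ^+ i :> R.
Proof.
have E (g : 'I_m -> nat) : injective g ->
   \prod_i \prod_j (-1) ^+ (g i < g j)%N = \prod_(i < m) \prod_(j < m | (i < j)%N) -1 :> R.
  move=> g_inj; rewrite prod_square_split big1 ?mul1r => [|i _]; last by rewrite ltnn.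
  apply: eq_bigr => i _; apply: eq_bigr => j ij; rewrite -signr_addb.
  have : g i != g j by rewrite (inj_eq g_inj) neq_ltn ij.
  by rewrite neq_ltn; case: ltngtP.
move=> /E ->; rewrite -(E _ (@ord_inj m)) exchange_big /=; apply: eq_bigr => i _.
rewrite -(big_mkord xpredT (fun x => (-1) ^+ (x < i)%N)).
rewrite (big_cat_nat (n := i) (leq0n _) (ltnW (ltn_ord i))) /=.
rewrite [X in _ * X]big_nat [X in _ * X]big1 ?mulr1; last first.
  by move=> k /andP[ik _]; rewrite ltnNge ik.
rewrite big_nat (eq_bigr (fun=> -1)) -?big_nat; last by move=> k /andP[_ ->].
by rewrite prodr_const_nat subn0.
Qed.

(** * The twist and its effect on signs *)

(** The minus sign sits on the left half so that stacking [A] over [twist A] gives, up to the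
    diagonal factor [D], the shape required by [det_rotation_block]. *)
Definition twist_sign (R : pzRingType) (n : nat) (k : 'I_(n + n)) : R :=
  match split k with inl i => - (-1) ^+ i | inr i => (-1) ^+ i end.

Definition twist (R : pzRingType) (n p : nat) (A : 'M[R]_(p, n + n)) : 'M[R]_(p, n + n) :=
  \matrix_(i, k) (twist_sign R k * A i (rho k)).

Lemma rho_lshift (n : nat) (i : 'I_n) : rho (lshift n i) = rshift n i.
Proof. by apply: val_inj; rewrite /= modn_small ?ltn_add2r // addnC. Qed.

Lemma rho_rshift (n : nat) (i : 'I_n) : rho (rshift n i) = lshift n i.
Proof.
apply: val_inj => /=; rewrite addnAC modnDl modn_small //.
exact: leq_trans (ltn_ord i) (leq_addr _ _).
Qed.

Lemma rhoK (n : nat) : involutive (@rho n).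
Proof.
by move=> k; rewrite -(splitK k); case: (split k) => i; rewrite !(rho_lshift, rho_rshift).
Qed.

Lemma twist_sign_lshift (R : pzRingType) (n : nat) (i : 'I_n) :
  twist_sign R (lshift n i) = - (-1) ^+ i.
Proof. by rewrite /twist_sign (unsplitK (inl i)). Qed.

Lemma twist_sign_rshift (R : pzRingType) (n : nat) (i : 'I_n) :
  twist_sign R (rshift n i) = (-1) ^+ i.
Proof. by rewrite /twist_sign (unsplitK (inr i)). Qed.

Lemma ltn_lrshift (m n : nat) (i : 'I_m) (j : 'I_n) : (lshift n i < rshift m j)%N.
Proof. exact: leq_trans (ltn_ord i) (leq_addr _ _). Qed.

Lemma ltn_rlshift (m n : nat) (i : 'I_n) (j : 'I_m) : (rshift m i < lshift n j)%N = false.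
Proof. by rewrite ltnNge ltnW // ltn_lrshift. Qed.

(** [rho] preserves the order of two values in the same half and reverses it across the halves. *)
Lemma ltn_rho_sign (R : pzRingType) (n : nat) (x y : 'I_(n + n)) :
  (-1) ^+ (y < x)%N * (-1) ^+ (rho y < rho x)%N =
  (-1) ^+ (n <= x)%N * (-1) ^+ (n <= y)%N :> R.
Proof.
rewrite -(splitK x) -(splitK y); case: (split x) => i; case: (split y) => j;
  rewrite !(rho_lshift, rho_rshift, ltn_lrshift, ltn_rlshift) /= ?ltn_add2l ?leq_addr
    ?(leqNgt n) ?ltn_ord -!signr_addb ?addbb //.
Qed.

Lemma inv_sign_split (R : comPzRingType) (m n : nat) (f : 'I_(m + n) -> nat) :
  inv_sign R f =
  inv_sign R (fun i => f (lshift n i)) * inv_sign R (fun i => f (rshift m i)) *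
  \prod_(j < n) \prod_(i < m) (-1) ^+ (f (rshift m j) < f (lshift n i))%N.
Proof.
rewrite /inv_sign big_split_ord /=.
have -> : \prod_(i < n) \prod_(j < m + n | (rshift m i < j)%N) (-1) ^+ (f j < f (rshift m i))%N
   = inv_sign R (fun i => f (rshift m i)).
  apply: eq_bigr => i _; rewrite big_mkcond big_split_ord /= big1 ?mul1r => [|j _].
    by rewrite -big_mkcond; apply: eq_bigl => j; rewrite ltn_add2l.
  by rewrite ltn_rlshift.
rewrite mulrAC; congr (_ * _); rewrite exchange_big -big_split; apply: eq_bigr => i _ /=.
rewrite big_mkcond big_split_ord /=; congr (_ * _); first by rewrite -big_mkcond.
by apply: eq_bigr => j _; rewrite ltn_lrshift.
Qed.

(* Split the inversions of s into those inside each half and those across; the ones inside the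
   right half differ from those of rho o s exactly at the pairs of values lying on
   different sides of n. *)
Lemma twist_sign_perm (R : realDomainType) (n : nat) (s : 'S_(n + n)) :
  (-1) ^+ s * \prod_(j < n) twist_sign R (s (rshift n j)) =
  \prod_(i < n) (-1) ^+ i * inv_sign R (fun i => s (lshift n i)) *
     inv_sign R (fun i => rho (s (rshift n i))).
Proof.
pose a (i : 'I_n) := s (lshift n i); pose b (j : 'I_n) := s (rshift n j).
pose u (j : 'I_n) : R := (-1) ^+ (n <= b j)%N.
have b_inj : injective b by move=> i j /perm_inj /rshift_inj.
have bV_inj : injective (fun j => b j : nat) by move=> i j /val_inj /b_inj.
pose X : R := \prod_(j < n) \prod_(i < n) (-1) ^+ (b j < a i)%N.
pose d : R := \prod_(i < n) (-1) ^+ i.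
have uu j : u j * u j = 1 by rewrite -signr_addb addbb.
have dd : d * d = 1 by rewrite -big_split big1 //= => i _; rewrite -expr2 sqrr_sign.
have sE : (-1) ^+ s = inv_sign R (fun i => a i) * inv_sign R (fun j => b j) * X.
  by rewrite perm_sign_inv_sign inv_sign_split.
(* Each [u j] occurs in n - 1 pairs; since [u j * u j = 1], the exponent can be taken to be
   [n.+1]. *)
have bE : inv_sign R (fun j => b j) * inv_sign R (fun j => rho (b j)) = \prod_j u j ^+ n.+1.
  transitivity (\prod_(i < n) \prod_(j < n | (i < j)%N) (u j * u i)).
    rewrite -big_split; apply: eq_bigr => i _; rewrite -big_split; apply: eq_bigr => j ij /=.
    by rewrite ltn_rho_sign mulrC.
  have E := prod_square_split (fun i j : 'I_n => u j).
  have U : \prod_j u j * \prod_j u j = 1 by rewrite -big_split big1 //= => j _; rewrite uu.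
  rewrite -[LHS]mul1r -[X in X * _]U -mulrA -E exchange_big -big_split.
  by apply: eq_bigr => j _ /=; rewrite prodr_const card_ord exprS.
(* [X] compares each [b j] with the values [a i], and [d], by [prod_sign_lt_inj], with the values
   [b i]. Together they count all 2n - 1 - [b j] values above [b j], a number of the parity of
   [(b j).+1]. *)
have XE : X * d = \prod_j (-1) ^+ (b j).+1.
  rewrite /d -(prod_sign_lt_inj R bV_inj) -big_split; apply: eq_bigr => j _ /=.
  transitivity (\prod_(k < n + n) (-1) ^+ (b j < k)%N : R).
    by rewrite (reindex_inj (@perm_inj _ s)) big_split_ord.
  by rewrite prod_sign_lt -signr_odd oddB ?ltn_ord // oddD addbb signr_odd.
(* Both sides are 1 when [b j] lies in the left half and (-1)^(n+1) when it lies in the right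
   half. *)
have tE j : (-1) ^+ (b j).+1 * twist_sign R (b j) = u j ^+ n.+1.
  rewrite /u; move: (b j) => k; rewrite -(splitK k); case: (split k) => i /=.
    rewrite twist_sign_lshift leqNgt ltn_ord expr1n exprS mulN1r mulrNN -signr_odd.
    by rewrite -signr_addb addbb.
  rewrite twist_sign_rshift leq_addr expr1 -exprD -addSn -addnA addnn exprD.
  by rewrite -mul2n exprM sqrrN !expr1n mulr1.
rewrite -/d -/a -/b.
have -> : inv_sign R (fun i => rho (s (rshift n i))) =
     inv_sign R (fun j => b j) * \prod_j u j ^+ n.+1.
  by rewrite -bE mulrA inv_sign_sqr mul1r.
have XdE : X = d * \prod_j (-1) ^+ (b j).+1 by rewrite -XE mulrCA dd mulr1.
have <- : \prod_j (-1) ^+ (b j).+1 * \prod_j twist_sign R (b j) = \prod_j u j ^+ n.+1.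
  by rewrite -big_split; apply: eq_bigr => j _; exact: tE.
rewrite sE XdE; set iL := inv_sign R _; set iR := inv_sign R _.
by rewrite [d * iL]mulrC -!mulrA; congr (_ * _); rewrite mulrCA.
Qed.

(** * From ordered column selections to maximal minors *)

(** [f] is the increasing enumeration [e] of its image precomposed with a permutation [t], whose
    sign is given by the inversions of [f]. *)
Lemma det_colsub_max_minor (R : realType) (n : nat) (A : 'M[R]_(n, n + n))
    (f : 'I_n -> 'I_(n + n)) : injective f ->
  \det (colsub f A) = inv_sign R (fun i => f i) * max_minor A (f @: 'I_n).
Proof.
move=> f_inj; set I := (f @: 'I_n)%SET.
have cI : #|I| = n by rewrite card_imset ?card_ord.
pose e (j : 'I_n) := nth (lshift n j) (enum I) j.
have szI : size (enum I) = n by rewrite -cardE.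
have fI i : f i \in enum I by rewrite mem_enum imset_f.
have idx_lt i : (index (f i) (enum I) < n)%N by rewrite -[X in (_ < X)%N]szI index_mem.
pose t0 i := Ordinal (idx_lt i).
have et i : e (t0 i) = f i by rewrite /e /= nth_index.
have t_inj : injective t0 by move=> i j /(congr1 e); rewrite !et => /f_inj.
pose t := perm t_inj.
have e_incr (i j : 'I_n) : (i < j)%N -> (e i < e j)%N.
  move=> ij; have srt : sorted ltn (map val (enum I)).
    rewrite {1}/enum_mem -enumT.
    apply: (subseq_sorted ltn_trans _ (iota_ltn_sorted 0 (n + n))).
    by rewrite -val_enum_ord; apply: map_subseq; apply: filter_subseq.
  have := sorted_ltn_nth ltn_trans 0%N srt.
  move=> /(_ i j); rewrite !inE size_map szI !ltn_ord => /(_ isT isT ij).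
  by rewrite (nth_map (lshift n i)) ?szI // (nth_map (lshift n j)) ?szI.
have e_inj : injective (fun i => e i : nat).
  by move=> i j eij; apply/val_inj; case: (ltngtP i j) => // /e_incr; rewrite eij ltnn.
have -> : inv_sign R (fun i => f i) = (-1) ^+ t.
  transitivity (inv_sign R ((fun i => e i : nat) \o t)).
    by apply: eq_bigr => i _; apply: eq_bigr => j _; rewrite /= !permE !et.
  by rewrite inv_sign_perm // inv_sign_increasing ?mulr1.
have -> : colsub f A = col_perm t (\matrix_(i, j) A i (e j)).
  by apply/matrixP=> i j; rewrite !mxE permE et.
by rewrite col_permE det_mulmx det_perm odd_permV mulrC.
Qed.

Lemma image_calR (n : nat) (s : 'S_(n + n)) :
  calR ((fun i => s (lshift n i)) @: 'I_n)%SET = ((fun i => rho (s (rshift n i))) @: 'I_n)%SET.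
Proof.
have -> : ((fun i => rho (s (rshift n i))) @: 'I_n)%SET =
    (@rho n @: [set s (rshift n i) | i in 'I_n])%SET by rewrite -imset_comp.
rewrite /calR; suff -> : (~: ((fun i => s (lshift n i)) @: 'I_n) =
    [set s (rshift n i) | i in 'I_n])%SET by [].
apply/setP => k; rewrite inE -[k](permKV s).
rewrite -(splitK (s^-1 k)%g); case: (split _) => i /=.
  rewrite imset_f //; apply/esym/negbTE/imsetP => -[j _ /perm_inj /eqP].
  by rewrite eq_lrshift.
rewrite [RHS]imset_f //; apply/imsetP => -[j _ /perm_inj /eqP].
by rewrite eq_rlshift.
Qed.

Lemma det_left_cols (R : realType) (n : nat) (A : 'M[R]_(n, n + n)) (s : 'S_(n + n)) :
  \det (left_cols s A) = inv_sign R (fun i => s (lshift n i)) *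
    max_minor A ((fun i => s (lshift n i)) @: 'I_n).
Proof. by rewrite -det_colsub_max_minor // => i j /perm_inj /lshift_inj. Qed.

(** The columns involved are those of [A] at [rho (s (rshift n j))], scaled by twist signs.
    [twist_sign_perm] evaluates the total sign, leaving the same one as in [det_left_cols]. *)
Lemma det_right_cols_twist (R : realType) (n : nat) (A : 'M[R]_(n, n + n)) (s : 'S_(n + n)) :
  \prod_(i < n) (-1) ^+ i * (-1) ^+ s * \det (right_cols s (twist A)) =
  inv_sign R (fun i => s (lshift n i)) *
    max_minor A (calR ((fun i => s (lshift n i)) @: 'I_n)).
Proof.
have -> : right_cols s (twist A) = colsub (fun j => rho (s (rshift n j))) A *m
    diag_mx (\row_j twist_sign R (s (rshift n j))).
  by rewrite mul_mx_diag; apply/matrixP=> i j; rewrite !mxE mulrC.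
rewrite det_mulmx det_diag det_colsub_max_minor; last first.
  by move=> i j /(inv_inj (@rhoK n)) /perm_inj /rshift_inj.
rewrite image_calR; under [X in _ * (_ * X)]eq_bigr do rewrite mxE.
set M := max_minor _ _; set T := \prod_j _; set r := inv_sign R (fun i => rho _).
set l := inv_sign R _; set d := \prod_i _.
have dd : d * d = 1 by rewrite -big_split big1 //= => i _; rewrite -expr2 sqrr_sign.
have /(congr1 (fun x => d * r * M * x)) := twist_sign_perm R s; rewrite -/T -/r -/l -/d.
have -> : d * r * M * (d * l * r) = (d * d) * (r * r) * (l * M).
  by move: d r M l {dd} => d r M l; ring.
rewrite dd inv_sign_sqr !mul1r => <-.
by move: ((-1) ^+ s) => e; move: d r M l T e {dd} => d r M l T e; ring.
Qed.

(** The common factor [inv_sign] in [det_left_cols] and [det_right_cols_twist] squares to 1 and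
    cancels; every n-element set is the image of the left half under some [s]. *)
Lemma calR_minors_complementary (R : realType) (n : nat) (A : 'M[R]_(n, n + n)) :
  (forall I : {set 'I_(n + n)}, #|I| = n -> max_minor A I = max_minor A (calR I)) <->
  (forall s : 'S_(n + n), \det (left_cols s A) =
     \prod_(i < n) (-1) ^+ i * (-1) ^+ s * \det (right_cols s (twist A))).
Proof.
split=> [minorE s | detE I cI].
  rewrite det_left_cols det_right_cols_twist -minorE // card_imset ?card_ord //.
  by move=> i j /perm_inj /lshift_inj.
pose f i := enum_val (cast_ord (esym cI) i).
have f_inj : injective f by move=> i j /enum_val_inj /cast_ord_inj.
have [s sE] := extend_injective f_inj.
have IE : I = ((fun i => s (lshift n i)) @: 'I_n)%SET.
  apply/esym/eqP; rewrite eqEcard cI card_imset ?card_ord ?leqnn ?andbT; last first.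
    by move=> i j /perm_inj /lshift_inj.
  by apply/fintype.subsetP => _ /imsetP [i _ ->]; rewrite sE enum_valP.
have := detE s; rewrite det_left_cols det_right_cols_twist -IE.
move/(congr1 ( *%R (inv_sign R (fun i => s (lshift n i))))).
by rewrite !mulrA inv_sign_sqr !mul1r.
Qed.

(** * Isotropy in matrix form *)

Lemma twist_mulmx (R : comPzRingType) (n p q : nat) (u : 'M[R]_(q, p)) (A : 'M[R]_(p, n + n)) :
  twist (u *m A) = u *m twist A.
Proof.
apply/matrixP=> i k; rewrite !mxE mulr_sumr; apply: eq_bigr => j _.
by rewrite !mxE mulrCA.
Qed.

Lemma formR_twist (R : realType) (n : nat) (x y : 'rV[R]_(n + n)) :
  formR x y = - (x *m (twist y)^T) 0 0.
Proof.
rewrite mxE big_split_ord /= -big_split /= -sumrN; apply: eq_bigr => i _.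
rewrite !mxE twist_sign_lshift twist_sign_rshift rho_lshift rho_rshift.
move: ((-1) ^+ i) (x _ _) (x _ _) (y _ _) (y _ _) => e a b c d; ring.
Qed.

Lemma twist_row_mx (R : comPzRingType) (n p : nat) (A : 'M[R]_(p, n + n)) :
  let D := diag_mx (\row_(i < n) (-1) ^+ i) in
  twist A = row_mx (- (rsubmx A *m D)) (lsubmx A *m D).
Proof.
rewrite /= !mul_mx_diag; apply/matrixP=> i k; rewrite !mxE -(splitK k).
case: (split k) => j; rewrite unsplitK !mxE ?(rho_lshift, rho_rshift).
  by rewrite twist_sign_lshift mulNr mulrC.
by rewrite twist_sign_rshift mulrC.
Qed.

(** If [v] is in the left kernel of the Gram matrix, then [v *m A] has zero sum of squares, hence
    vanishes. *)
Lemma det_gram_neq0 (F : realFieldType) (m n : nat) (A : 'M[F]_(m, n)) :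
  row_free A -> \det (A *m A^T) != 0.
Proof.
move=> Afree; apply/det0P => -[v v0 /(congr1 (mulmxr v^T))] /=.
rewrite mul0mx mulmxA -mulmxA -trmx_mul => vAAv.
case/negP: v0; rewrite -(mulmx_free_eq0 v Afree); apply/eqP/rowP => k; rewrite mxE.
have /eqP := congr1 (fun M : 'M_1 => M 0 0) vAAv.
rewrite !mxE psumr_eq0 => [/allP/(_ k)|i _]; last by rewrite !mxE -expr2 sqr_ge0.
rewrite mem_index_enum => /(_ isT); rewrite [_^T _ _]mxE -expr2 sqrf_eq0 => /eqP.
by rewrite mxE.
Qed.

Lemma isotropic_complementary_minors (R : rcfType) (n : nat) (A : 'M[R]_(n, n + n)) :
  row_free A -> A *m (twist A)^T = 0 -> forall s : 'S_(n + n),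
  \det (left_cols s A) =
    \prod_(i < n) (-1) ^+ i * (-1) ^+ s * \det (right_cols s (twist A)).
Proof.
move=> Afree AN s; have := complementary_minors s AN; move: AN.
have := twist_row_mx A; have /= := det_gram_neq0 Afree.
set D := diag_mx _; set N := twist A; set B := lsubmx A; set C := rsubmx A => g0 NE.
have DT : D^T = D by rewrite tr_diag_mx.
have DD : D *m D = 1%:M.
  rewrite mulmx_diag -diag_const_mx; congr diag_mx; apply/rowP => i.
  by rewrite !mxE -expr2 sqrr_sign.
have dD : \det D = \prod_(i < n) (-1) ^+ i by rewrite det_diag; under eq_bigr do rewrite mxE.
have AE : A = row_mx B C by rewrite hsubmxK.
have NN : N *m N^T = A *m A^T.
  rewrite NE AE !tr_row_mx !mul_row_col linearN /= mulNmx mulmxN opprK !trmx_mul DT.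
  by rewrite !mulmxA -(mulmxA C) -(mulmxA B) DD !mulmx1 addrC.
(* In blocks, isotropy is the symmetry hypothesis of [det_rotation_block_rcf] for [B] and
   [C *m D]. *)
move=> AN; have BC : B *m (C *m D)^T = C *m D *m B^T.
  move/eqP: AN; rewrite AE NE tr_row_mx mul_row_col linearN mulmxN addrC subr_eq0.
  by move/eqP <-; rewrite trmx_mul DT mulmxA.
have -> : col_mx A N =
     block_mx B (C *m D) (- (C *m D)) B *m block_mx 1%:M 0 0 D.
  rewrite mulmx_block !mulmx0 !mulmx1 !addr0 !add0r -(mulmxA C) DD mulmx1.
  by rewrite NE /block_mx -AE.
rewrite det_mulmx det_ublock det1 mul1r dD det_rotation_block_rcf // NN.
have -> : B *m B^T + C *m D *m (C *m D)^T = A *m A^T.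
  by rewrite AE tr_row_mx mul_row_col trmx_mul DT mulmxA -(mulmxA C) DD mulmx1.
(* The Gram determinant of [A] occurs on both sides and cancels, leaving [\det D] as the
   constant. *)
rewrite mulrCA [RHS]mulrC => /(mulfI g0) <-.
by rewrite mulrC mulrA.
Qed.

(** * Representing matrices and Plücker coordinates *)

Lemma represents_row_free (R : realType) (n : nat) (A : 'M[R]_(n, n + n))
    (X : {vspace 'rV[R]_(n + n)}) : represents A X -> row_free A.
Proof.
move=> AX; apply: inj_row_free => v vA.
have sz : size [seq row i A | i <- enum 'I_n] == n by rewrite size_map size_enum_ord.
have /freeP := basis_free AX : free (Tuple sz).
move=> /(_ (fun i => v 0 i)) v0; apply/rowP => i; rewrite mxE; apply: v0.
rewrite -[RHS]vA mulmx_sum_row; apply: eq_bigr => j _; congr (_ *: _) => /=.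
by rewrite (nth_map j) ?size_enum_ord // nth_ord_enum.
Qed.

Lemma represents_mem (R : realType) (n : nat) (A : 'M[R]_(n, n + n))
    (X : {vspace 'rV[R]_(n + n)}) x : represents A X ->
  x \in X <-> exists u, x = u *m A.
Proof.
move=> AX; split=> [|[u ->]].
  rewrite -(span_basis AX) => xA.
  have sz : size [seq row i A | i <- enum 'I_n] == n by rewrite size_map size_enum_ord.
  have /coord_span -> : x \in <<Tuple sz>>%VS by [].
  exists (\row_i coord (Tuple sz) i x); rewrite mulmx_sum_row; apply: eq_bigr => j _.
  by rewrite mxE /= (nth_map j) ?size_enum_ord // nth_ord_enum.
rewrite mulmx_sum_row memv_suml // => i _; apply/memvZ/(basis_mem AX).
by apply: map_f; rewrite mem_enum.
Qed.

Lemma represents_exists (R : realType) (n : nat) (X : {vspace 'rV[R]_(n + n)}) :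
  \dim X = n -> exists A, represents A X.
Proof.
move=> dX; exists (\matrix_(i < n) (vbasis X)`_i).
rewrite /represents.
have -> : [seq row i (\matrix_(i0 < n) (vbasis X)`_i0) | i <- enum 'I_n] = vbasis X.
  apply: (@eq_from_nth _ 0) => [|i]; first by rewrite size_map size_enum_ord size_tuple.
  rewrite size_map size_enum_ord => ltin.
  rewrite (nth_map (Ordinal ltin)) ?size_enum_ord // rowK.
  by congr (_`_ _); rewrite (nth_ord_enum _ (Ordinal ltin)).
exact: vbasisP.
Qed.

(** Up to sign, the entries of [A *m (twist A)^T] are the values of [formR] at pairs of rows of [A],
    and these rows span [X]. *)
Lemma represents_isotropic (R : realType) (n : nat) (A : 'M[R]_(n, n + n))
    (X : {vspace 'rV[R]_(n + n)}) : represents A X ->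
  (forall x y, x \in X -> y \in X -> formR x y = 0) <-> A *m (twist A)^T = 0.
Proof.
move=> AX; split=> [isoX | AN x y].
  apply/matrixP => i j; rewrite [RHS]mxE; apply/eqP; rewrite -oppr_eq0; apply/eqP.
  rewrite -(isoX (row i A) (row j A)).
  - rewrite formR_twist (rowE j) twist_mulmx -rowE !mxE; congr (- _).
    by apply: eq_bigr => k _; rewrite !mxE.
  - by apply/(represents_mem _ AX); exists (delta_mx 0 i); rewrite rowE.
  - by apply/(represents_mem _ AX); exists (delta_mx 0 j); rewrite rowE.
move=> /(represents_mem _ AX) [u ->] /(represents_mem _ AX) [v ->].
rewrite formR_twist twist_mulmx trmx_mul mulmxA -(mulmxA u) AN mulmx0 mul0mx mxE.
by rewrite oppr0.
Qed.

Lemma isotropic_calR_minors (R : realType) (n : nat) (A : 'M[R]_(n, n + n))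
    (X : {vspace 'rV[R]_(n + n)}) : represents A X ->
  (forall x y, x \in X -> y \in X -> formR x y = 0) <->
  (forall I : {set 'I_(n + n)}, #|I| = n -> max_minor A I = max_minor A (calR I)).
Proof.
move=> AX; have Afree := represents_row_free AX.
rewrite calR_minors_complementary (represents_isotropic AX); split.
  exact: isotropic_complementary_minors.
(* The constant [c] is the product of the signs [(-1) ^+ i], that is, [\det D]. *)
exact: orthogonal_of_complementary_minors.
Qed.

Lemma card_calR (n : nat) (I : {set 'I_(n + n)}) : #|I| = n -> #|calR I| = n.
Proof.
move=> cI; rewrite card_imset; last exact: (inv_inj (@rhoK n)).
by have := cardsC I; rewrite cI card_ord => /addnI.
Qed.

(** The equalities are homogeneous, so the nonzero scalar cancels and any choice of scaling will
    do. *)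
Lemma isotropic_calR_plucker (R : realType) (n : nat) (X : {vspace 'rV[R]_(n + n)})
    (p : {set 'I_(n + n)} -> R) : is_plucker X p ->
  (forall x y, x \in X -> y \in X -> formR x y = 0) <->
  (forall I : {set 'I_(n + n)}, #|I| = n -> p I = p (calR I)).
Proof.
case=> A [AX [c [c0 pE]]]; rewrite (isotropic_calR_minors AX).
split=> E I cI; first by rewrite !pE ?card_calR // E.
by apply: (mulfI c0); rewrite -!pE ?card_calR // E.
Qed.

Theorem proposition3p8 (R : realType) (n : nat) (hn : (1 <= n)%N) :
  LGR R n =
    [set X : {vspace 'rV[R]_(n + n)} | Gr R n X /\
      exists p, is_plucker X p /\
        forall I : {set 'I_(n + n)}, #|I| = n -> p I = p (calR I)]
  /\
  LGR_ge0 R n =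
    [set X : {vspace 'rV[R]_(n + n)} | Gr R n X /\
      exists p, is_plucker X p /\
        forall I : {set 'I_(n + n)}, #|I| = n ->
          p I = p (calR I) /\ 0 <= p (calR I)].
Proof.
split; apply/seteqP; split=> X /=.
- case=> GX isoX; split=> //; have [A AX] := represents_exists GX.
  have pX : is_plucker X (max_minor A).
    by exists A; split=> //; exists 1; split=> [|I _]; rewrite ?oner_neq0 ?mul1r.
  by exists (max_minor A); split=> //; apply/(isotropic_calR_plucker pX).
- by case=> GX [p [pX pE]]; split=> //; apply/(isotropic_calR_plucker pX).
(* The scaling that makes the coordinates nonnegative also satisfies the equalities, as these hold
   for every scaling. *)
- case=> -[GX isoX] [_ [p [pX p_ge0]]]; split=> //; exists p; split=> // I cI.
  by split; [apply: (isotropic_calR_plucker pX).1 | rewrite p_ge0 ?card_calR].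
- case=> GX [p [pX pE]]; have pR (I : {set _}) : #|I| = n -> p I = p (calR I) by move=> /pE [].
  split; split=> //; first by apply/(isotropic_calR_plucker pX).
  by exists p; split=> // I cI; rewrite pR //; case: (pE I cI).
Qed.
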